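(* Let $\mu,\nu\in\mathcal{P}(\mathbb{R}^2)$ and let $c(\mathbf{x},\mathbf{y}):=|x_1-y_1|^2+|x_2-y_2|^2$. Suppose there exist $a,b,q\in\mathbb{R}$ with $(a,b)\neq(0,0)$ such that $$\mu(\{ax_1+bx_2=q\})=1.$$ Let $O:\mathbb{R}^2\to\mathbb{R}^2$ be a rotation that sends the set $\{x_2=0\}$ onto $\{ax_1+bx_2=q\}$, and let $\pi$ be an optimal transportation plan between $(O^{-1})_\#\mu$ and $(O^{-1})_\#\nu$ for the cost $c$. Then $\pi_O:=(O,O)_\#\pi$ is an optimal transportation plan between $\mu$ and $\nu$ for the cost $c$.
   Context: $\mathcal{P}(\mathbb{R}^2)$ denotes the Borel probability measures on $\mathbb{R}^2$; $T_\#$ denotes push-forward; $(O,O)$ denotes the map $(\mathbf{x},\mathbf{y})\mapsto(O(\mathbf{x}),O(\mathbf{y}))$. An optimal transportation plan between $\alpha,\beta\in\mathcal{P}(\mathbb{R}^2)$ for the cost $c$ is a minimizer of $\pi\mapsto\int_{\mathbb{R}^2\times\mathbb{R}^2}c\,d\pi$ over the set of probability measures on $\mathbb{R}^2\times\mathbb{R}^2$ with marginals $\alpha$ and $\beta$. A rotation here is an orientation-preserving Euclidean isometry of the plane (not necessarily fixing the origin). *)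

(* Defs.v *)
From HB Require Import structures.
From mathcomp Require Import all_boot all_order all_algebra.
From mathcomp Require Import all_classical all_reals all_analysis.

Set Implicit Arguments.
Unset Strict Implicit.
Unset Printing Implicit Defensive.

Import Order.TTheory GRing.Theory Num.Theory.
Import numFieldNormedType.Exports.

Local Open Scope classical_set_scope.
Local Open Scope ring_scope.

(* The product sigma-algebra of R * R is the Borel sigma-algebra of the plane,
   so [probability (plane R) R] is the type of Borel probability measures. *)
Notation plane R := (R * R)%type.

(* The library norm on R * R is the sup norm, hence the explicit formula. *)
Definition edist (R : realType) (x y : plane R) : R :=
  Num.sqrt ((x.1 - y.1) ^+ 2 + (x.2 - y.2) ^+ 2).

Definition is_isometry (R : realType) (O : plane R -> plane R) : Prop :=
  forall x y, edist (O x) (O y) = edist x y.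

(* det (y - x, z - x): twice the signed area of the triangle x y z, which is
   positive iff x, y, z are in counterclockwise order. *)
Definition signed_area2 (R : realType) (x y z : plane R) : R :=
  (y.1 - x.1) * (z.2 - x.2) - (y.2 - x.2) * (z.1 - x.1).

Definition orientation_preserving (R : realType) (O : plane R -> plane R) :
    Prop :=
  forall x y z, 0 < signed_area2 x y z -> 0 < signed_area2 (O x) (O y) (O z).

(* Translations count as rotations: no fixed point is required. *)
Definition is_rotation (R : realType) (O : plane R -> plane R) : Prop :=
  is_isometry O /\ orientation_preserving O.

(* [pinv setT O] is the two-sided inverse when O is bijective, as every isometry
   of the plane is. *)
Definition inverse_map (R : realType) (O : plane R -> plane R) :
  plane R -> plane R := pinv setT O.

Definition map_both (T : Type) (O : T -> T) (z : T * T) : T * T :=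
  (O z.1, O z.2).

Definition sq_cost (R : realType) (x y : plane R) : R :=
  `|x.1 - y.1| ^+ 2 + `|x.2 - y.2| ^+ 2.

(* Measures are carried by their underlying set functions, so that push-forwards
   can be used without first proving measurability of the map. That pi is a
   probability measure is part of the definition; its marginals are compared
   with alpha and beta on measurable sets only, because library measures are
   arbitrary outside of them. *)
Definition transport_plan (R : realType) (alpha beta : set (plane R) -> \bar R)
    (pi : set (plane R * plane R) -> \bar R) : Prop :=
  [/\ exists P : probability (plane R * plane R)%type R,
        pi = (P : set (plane R * plane R) -> \bar R),
      forall A, measurable A -> pushforward pi fst A = alpha A &
      forall B, measurable B -> pushforward pi snd B = beta B].

(* The costs used are nonnegative, so the integral always makes sense in
   [0, +oo]; the minimum is allowed to be +oo. *)
Definition optimal_plan (R : realType) (c : plane R -> plane R -> R)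
    (alpha beta : set (plane R) -> \bar R)
    (pi : set (plane R * plane R) -> \bar R) : Prop :=
  transport_plan alpha beta pi /\
  forall pi', transport_plan alpha beta pi' ->
    (\int[pi]_z (c z.1 z.2)%:E <= \int[pi']_z (c z.1 z.2)%:E)%E.

(* Main.v *)
(* A planar isometry O preserves the cost and is affine, hence a bimeasurable
   bijection. So (O, O)_# and (O^-1, O^-1)_# are mutually inverse,
   cost-preserving correspondences between the plans for the pulled-back
   marginals and the plans for mu and nu, and they exchange minimizers. *)
Require Import Defs.
From HB Require Import structures.
From mathcomp Require Import all_boot all_order all_algebra.
From mathcomp Require Import all_classical all_reals all_analysis.
From mathcomp Require Import measurable_realfun ring lra.

Set Implicit Arguments.
Unset Strict Implicit.
Unset Printing Implicit Defensive.

Import Order.TTheory GRing.Theory Num.Theory.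
Import numFieldNormedType.Exports.

Local Open Scope classical_set_scope.
Local Open Scope ring_scope.

Lemma sq_cost_edist (R : realType) (x y : plane R) :
  sq_cost x y = Defs.edist x y ^+ 2.
Proof.
by rewrite /sq_cost /Defs.edist !real_normK ?num_real// sqr_sqrtr// addr_ge0// sqr_ge0.
Qed.

Lemma isometry_sq_cost (R : realType) (f : plane R -> plane R) :
  is_isometry f -> forall x y, sq_cost (f x) (f y) = sq_cost x y.
Proof. by move=> f_isom x y; rewrite !sq_cost_edist f_isom. Qed.

(** Orthogonality and unit lengths alone force the pair to span the plane. In [isometry_affine] this
    yields surjectivity of the isometry. *)
Lemma orthonormal_coordinates (R : realType) (u1 u2 v1 v2 w1 w2 : R) :
  u1 ^+ 2 + u2 ^+ 2 = 1 -> v1 ^+ 2 + v2 ^+ 2 = 1 -> u1 * v1 + u2 * v2 = 0 ->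
  let s := w1 * u1 + w2 * u2 in let t := w1 * v1 + w2 * v2 in
  w1 = s * u1 + t * v1 /\ w2 = s * u2 + t * v2.
Proof.
move=> u_unit v_unit uv_orth s t; rewrite {}/s {}/t.
(* v is the quarter turn of u up to the sign d *)
pose d := u1 * v2 - u2 * v1.
have v1E : v1 = - d * u2.
  transitivity (v1 * (u1 ^+ 2 + u2 ^+ 2)); first by rewrite u_unit mulr1.
  transitivity (- d * u2 + u1 * (u1 * v1 + u2 * v2)); first by rewrite /d; ring.
  by rewrite uv_orth mulr0 addr0.
have v2E : v2 = d * u1.
  transitivity (v2 * (u1 ^+ 2 + u2 ^+ 2)); first by rewrite u_unit mulr1.
  transitivity (d * u1 + u2 * (u1 * v1 + u2 * v2)); first by rewrite /d; ring.
  by rewrite uv_orth mulr0 addr0.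
have d_sq : d ^+ 2 = 1.
  transitivity (d ^+ 2 * (u1 ^+ 2 + u2 ^+ 2)); first by rewrite u_unit mulr1.
  by rewrite -v_unit v1E v2E; ring.
clearbody d; split.
- transitivity (w1 * (u1 ^+ 2 + u2 ^+ 2)); first by rewrite u_unit mulr1.
  transitivity ((w1 * u1 + w2 * u2) * u1 + d ^+ 2 * (w1 * u2 - w2 * u1) * u2).
    by rewrite d_sq; ring.
  by rewrite v1E v2E; ring.
- transitivity (w2 * (u1 ^+ 2 + u2 ^+ 2)); first by rewrite u_unit mulr1.
  transitivity ((w1 * u1 + w2 * u2) * u2 + d ^+ 2 * (w2 * u1 - w1 * u2) * u1).
    by rewrite d_sq; ring.
  by rewrite v1E v2E; ring.
Qed.

Definition affine_frame (R : realType) (p u v x : plane R) : plane R :=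
  (p.1 + (x.1 * u.1 + x.2 * v.1), p.2 + (x.1 * u.2 + x.2 * v.2)).

(** The linear part is the transpose of that of [affine_frame], hence its inverse once [u] and [v]
    are orthonormal. *)
Definition frame_coord (R : realType) (p u v y : plane R) : plane R :=
  ((y.1 - p.1) * u.1 + (y.2 - p.2) * u.2, (y.1 - p.1) * v.1 + (y.2 - p.2) * v.2).

(** An isometry is determined by the images of the origin and of the two unit vectors, which form an
    orthonormal frame based at [p]. The explicit inverse is what later gives measurability in both
    directions. *)
Lemma isometry_affine (R : realType) (f : plane R -> plane R) : is_isometry f ->
  exists p u v : plane R,
    [/\ f = affine_frame p u v, cancel f (frame_coord p u v)
      & cancel (frame_coord p u v) f].
Proof.
move=> f_isom; set p := f (0, 0).
pose u := f (1, 0) - p; pose v := f (0, 1) - p.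
have dist2 x y : ((f x).1 - (f y).1) ^+ 2 + ((f x).2 - (f y).2) ^+ 2 =
    (x.1 - y.1) ^+ 2 + (x.2 - y.2) ^+ 2.
  have := isometry_sq_cost f_isom x y.
  by rewrite /sq_cost !real_normK ?num_real.
have u1E : u.1 = (f (1, 0)).1 - p.1 by [].
have u2E : u.2 = (f (1, 0)).2 - p.2 by [].
have v1E : v.1 = (f (0, 1)).1 - p.1 by [].
have v2E : v.2 = (f (0, 1)).2 - p.2 by [].
have u_unit : u.1 ^+ 2 + u.2 ^+ 2 = 1.
  by rewrite u1E u2E dist2/=; ring.
have v_unit : v.1 ^+ 2 + v.2 ^+ 2 = 1.
  by rewrite v1E v2E dist2/=; ring.
(* Converse of Pythagoras: the squared distance between the images of the unit vectors is 2, that is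
   |u|^2 + |v|^2. *)
have uv_orth : u.1 * v.1 + u.2 * v.2 = 0.
  have := dist2 (1, 0) (0, 1); have := dist2 (1, 0) (0, 0).
  have := dist2 (0, 1) (0, 0); rewrite -/p u1E u2E v1E v2E /=; lra.
(* polarization: inner products with u and v are differences of squared distances *)
have coord x : frame_coord p u v (f x) = x.
  have := dist2 x (0, 0); have := dist2 x (1, 0); have := dist2 x (0, 1).
  have := dist2 (1, 0) (0, 0); have := dist2 (0, 1) (0, 0).
  rewrite -/p /frame_coord u1E u2E v1E v2E; case: x => x1 x2 /= e1 e2 e3 e4 e5.
  by congr pair; lra.
have frame y : affine_frame p u v (frame_coord p u v y) = y.
  have [e1 e2] := orthonormal_coordinates (y.1 - p.1) (y.2 - p.2)
    u_unit v_unit uv_orth.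
  rewrite /affine_frame /frame_coord /= -e1 -e2.
  by case: y {e1 e2} => y1 y2 /=; rewrite !subrKC.
(* The point [f x] is rebuilt from its frame coordinates, which are those of [x]. *)
have fE x : f x = affine_frame p u v x by rewrite -{2}[x]coord frame.
exists p, u, v; split=> [|//|y]; first exact/funext.
by rewrite fE frame.
Qed.

Lemma measurable_affine_frame (R : realType) (p u v : plane R) :
  measurable_fun setT (affine_frame p u v).
Proof.
apply: measurable_fun_pair; apply: measurable_funD => //;
  by apply: measurable_funD; apply: measurable_funM.
Qed.

Lemma measurable_frame_coord (R : realType) (p u v : plane R) :
  measurable_fun setT (frame_coord p u v).
Proof.
by apply: measurable_fun_pair; apply: measurable_funD;
  apply: measurable_funM => //; apply: measurable_funB.
Qed.

Lemma isometry_inverse_map (R : realType) (f : plane R -> plane R) :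
  is_isometry f ->
  [/\ cancel f (inverse_map f), cancel (inverse_map f) f,
      measurable_fun setT f & measurable_fun setT (inverse_map f)].
Proof.
move=> /isometry_affine[p [u [v [fE fK Kf]]]].
have inv_fK : cancel f (inverse_map f).
  move=> x; apply: (@pinvKV _ _ _ setT f); last exact: in_setT.
  by move=> ? ? _ _; exact: (can_inj fK).
(* A left inverse of the surjection [f] is unique, so the abstractly chosen [pinv] is the affine map
   [frame_coord], whose measurability is plain. *)
have invE : inverse_map f = frame_coord p u v.
  by apply/funext => y; rewrite -{1}[y]Kf inv_fK.
split => //; rewrite ?invE //.
- by rewrite fE; exact: measurable_affine_frame.
- exact: measurable_frame_coord.
Qed.

Lemma measurable_sq_cost (R : realType) :
  measurable_fun setT (fun z : plane R * plane R => (sq_cost z.1 z.2)%:E).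
Proof.
apply/measurable_EFinP; apply: measurable_funD; apply: measurable_funX;
  apply: measurableT_comp => //; apply: measurable_funB;
  exact: measurableT_comp.
Qed.

Lemma measurable_map_both d (T : measurableType d) (f : T -> T) :
  measurable_fun setT f -> measurable_fun setT (map_both f).
Proof.
by move=> mf; apply: measurable_fun_pair; apply: measurableT_comp.
Qed.

(** Both projections commute with the maps: [fst \o map_both f] is [f \o fst] by computation, and
    likewise for [snd]. *)
Lemma transport_plan_pushforward (R : realType) (f : plane R -> plane R)
    (alpha beta : set (plane R) -> \bar R)
    (pi : set (plane R * plane R) -> \bar R) : measurable_fun setT f ->
  transport_plan alpha beta pi ->
  transport_plan (pushforward alpha f) (pushforward beta f)
    (pushforward pi (map_both f)).
Proof.
move=> mf [[P ->] margl margr].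
have mpre A : measurable A -> measurable (f @^-1` A).
  by move=> mA; rewrite -[_ @^-1` _]setTI; exact: mf.
split=> [|A mA|B mB].
- by exists (distribution P (mfun_Sub (mem_set (measurable_map_both mf)))).
- by rewrite /pushforward -margl//; exact: mpre.
- by rewrite /pushforward -margr//; exact: mpre.
Qed.

(** Change of variables for a nonnegative integrand, so infinite costs are covered too. *)
Lemma integral_cost_pushforward (R : realType) (c : plane R -> plane R -> R)
    (f : plane R -> plane R) (P : probability (plane R * plane R)%type R) :
  (forall x y, 0 <= c x y) ->
  measurable_fun setT (fun z : plane R * plane R => (c z.1 z.2)%:E) ->
  measurable_fun setT f -> (forall x y, c (f x) (f y) = c x y) ->
  (\int[pushforward P (map_both f)]_z (c z.1 z.2)%:E =
   \int[P]_z (c z.1 z.2)%:E)%E.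
Proof.
move=> c_ge0 mc mf fc.
rewrite ge0_integral_pushforward//=; first last.
- by move=> z _; rewrite lee_fin.
- exact: measurable_map_both.
by rewrite preimage_setT; apply: eq_integral => z _; rewrite fc.
Qed.

(** The equality holds on every set, measurable or not, so it can rewrite the marginals inside
    [optimal_plan]. *)
Lemma pushforwardK d1 d2 (T1 : sigmaRingType d1) (T2 : sigmaRingType d2)
    (R : realFieldType) (m : set T1 -> \bar R) (f : T1 -> T2) (g : T2 -> T1) :
  cancel f g -> pushforward (pushforward m f) g = m.
Proof.
move=> fK; apply/funext => A; rewrite /pushforward -comp_preimage.
by congr m; apply/seteqP; split=> x /=; rewrite fK.
Qed.

Lemma optimal_plan_pushforward (R : realType) (c : plane R -> plane R -> R)
    (f g : plane R -> plane R) (alpha beta : set (plane R) -> \bar R)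
    (pi : set (plane R * plane R) -> \bar R) :
  (forall x y, 0 <= c x y) ->
  measurable_fun setT (fun z : plane R * plane R => (c z.1 z.2)%:E) ->
  cancel f g -> cancel g f -> measurable_fun setT f -> measurable_fun setT g ->
  (forall x y, c (f x) (f y) = c x y) ->
  optimal_plan c alpha beta pi ->
  optimal_plan c (pushforward alpha f) (pushforward beta f)
    (pushforward pi (map_both f)).
Proof.
move=> c_ge0 mc fK gK mf mg fc [pi_plan pi_min].
have gc x y : c (g x) (g y) = c x y by rewrite -fc !gK.
split; first exact: transport_plan_pushforward.
move=> pi' pi'_plan.
(* The competitor is carried back by [g] to a plan between [alpha] and [beta], where [pi] is
   minimal. *)
have := transport_plan_pushforward mg pi'_plan.
rewrite !(pushforwardK _ fK) => /pi_min.
(* Exposing the underlying probabilities makes the change of variables applicable to both sides. *)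
case: pi_plan pi'_plan => -[P ->] _ _ [[P' ->] _ _].
by rewrite !integral_cost_pushforward.
Qed.

Theorem corollary4 (R : realType) (mu nu : probability (plane R) R)
    (a b q : R) (ab_neq0 : (a, b) <> (0, 0))
    (mu_line : mu [set x : plane R | a * x.1 + b * x.2 = q] = 1%E)
    (O : plane R -> plane R) (O_rot : is_rotation O)
    (O_line : O @` [set x : plane R | x.2 = 0] = [set x : plane R | a * x.1 + b * x.2 = q])
    (pi : probability (plane R * plane R)%type R)
    (pi_opt : optimal_plan (@sq_cost R)
                (pushforward mu (inverse_map O))
                (pushforward nu (inverse_map O)) pi) :
  optimal_plan (@sq_cost R) mu nu (pushforward pi (map_both O)).
Proof.
have [isom_O _] := O_rot.
have [invK KO mO mO_inv] := isometry_inverse_map isom_O.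
(* Each marginal is written as the image under [O] of its pull-back, the form required by the
   transfer lemma. *)
rewrite -(pushforwardK mu KO) -(pushforwardK nu KO).
apply: (optimal_plan_pushforward _ _ invK KO mO mO_inv _ pi_opt).
- by move=> x y; rewrite sq_cost_edist sqr_ge0.
- exact: measurable_sq_cost.
- exact: isometry_sq_cost.
Qed.
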